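(* Let $T(x,t)$ (together with the auxiliary functions $\zeta_1(t),\dots,\zeta_N(t)$) be the solution of the reduced problem $$\left\{\begin{aligned} &T_t+aT_{tt}=K\left(T_{xx}+bT_{txx}\right)+F(x,t),\quad (x,t)\in[0,x_r]\times(0,D],\\ &T(x,0)=\xi_1(x),\quad T_t(x,0)=\eta_1(x),\quad x\in[0,x_r],\\ &T(0,t)=0,\quad t\in(0,D],\\ &T_x(x_r,t)+bT_{tx}(x_r,t)+\sqrt{\tfrac{z_0}{K}}\Big[\Big(1+\sum_{n=1}^N\tfrac{a_n}{b_n}\Big)T_t(x_r,t)-z_0\sum_{n=1}^N\tfrac{a_n}{b_n}\zeta_n'(t)\Big]=Q(t),\quad t\in(0,D],\\ &(z_0-b_nz_0)\zeta_n'(t)+b_n\left[\zeta_n(t)+(a+b)\zeta_n'(t)+ab\,\zeta_n''(t)\right]=T_t(x_r,t)+R(t),\quad t\in(0,D],\ n=1,\dots,N,\\ &\zeta_n(0)=\zeta_n'(0)=0,\quad n=1,\dots,N. \end{aligned}\right.$$ Then for every $t\in(0,D]$, $$\begin{aligned} \|T(\cdot,t)\|^2_{L^2(0,x_r)}\le{}&\frac{x_r^2K^{1/2}(2N+1)}{4\sqrt{z_0}}\int_0^tQ^2(s)\,ds+\frac{x_r^2z_0^{3/2}}{4\sqrt{K}(a+b)}\int_0^t\sum_{n=1}^N\frac{a_n}{b_n^2}R^2(s)\,ds+\frac{x_r^2}{2}\left\|\frac{d\xi_1}{dx}\right\|^2_{L^2(0,x_r)}\\ &+\frac{x_r^2}{2K}\int_0^t\|F(\cdot,s)\|^2_{L^2(0,x_r)}\,ds+\frac{a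 x_r^2}{2K}\|\eta_1\|^2_{L^2(0,x_r)}. \end{aligned}$$
   Context: $a,b,K,D,x_r,z_0>0$ are given constants and $N\ge1$ is an integer. For $n=1,\dots,N$, $$b_n=\cos^2\left(\frac{n\pi}{2N+1}\right),\qquad a_n=\frac{2}{2N+1}\sin^2\left(\frac{n\pi}{2N+1}\right).$$ The data are given by functions $f(x,t)$ (source), $\xi(x),\eta(x)$ (initial data), $\phi(t)$ (boundary data) through $F(x,t)=f(x,t)-\phi'(t)-a\phi''(t)$, $\xi_1(x)=\xi(x)-\phi(0)$, $\eta_1(x)=\eta(x)-\phi'(0)$, $Q(t)=-\sqrt{z_0/K}\,\big(1+\sum_{n=1}^N a_n/b_n\big)\phi'(t)$, $R(t)=\phi'(t)$. The functions $f,\xi,\eta,\phi$ are continuous, $f$ is supported in $[0,x_r]\times[0,D]$ and $\xi,\eta$ are supported in $[0,x_r]$. Subscripts $t,x$ denote partial derivatives. $\|u\|_{L^2(0,x_r)}^2=\int_0^{x_r}u(x)^2dx$. The data and the solution $(T,\zeta_1,\dots,\zeta_N)$ are assumed smooth enough (up to $t=0$ and up to the boundary) for the equations to hold classically and for the derivatives appearing in them, and those of the integrals involved, to be continuous. *)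

(* Defs.v *)
From Stdlib Require Import Reals.
From Coquelicot Require Import Coquelicot.
Open Scope R_scope.

Definition on_int (l u : R) (x : R) : Prop := l <= x <= u.

Definition on_rect (xr D : R) (p : R * R) : Prop :=
  on_int 0 xr (fst p) /\ on_int 0 D (snd p).

(* The derivative is relative to the closed interval [l, u], hence one-sided
   at l and at u: values of g outside [l, u] play no role. *)
Definition deriv_on (l u : R) (g dg : R -> R) : Prop :=
  forall x : R, on_int l u x -> D_in g dg (on_int l u) x.

Definition C1_on (l u : R) (g dg : R -> R) : Prop :=
  deriv_on l u g dg /\ continuous_on (on_int l u) dg.

Definition continuous_on_rect (xr D : R) (u : R -> R -> R) : Prop :=
  continuous_on (on_rect xr D) (fun p : R * R => u (fst p) (snd p)).

Definition partial_x (xr D : R) (u du : R -> R -> R) : Prop :=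
  forall t : R, on_int 0 D t ->
    deriv_on 0 xr (fun x => u x t) (fun x => du x t).

Definition partial_t (xr D : R) (u du : R -> R -> R) : Prop :=
  forall x : R, on_int 0 xr x -> deriv_on 0 D (u x) (du x).

Definition L2_norm_sq (xr : R) (u : R -> R) : R := RInt (fun x => u x ^ 2) 0 xr.

Definition coef_b (N n : nat) : R :=
  cos (INR n * PI / (2 * INR N + 1)) ^ 2.

Definition coef_a (N n : nat) : R :=
  2 / (2 * INR N + 1) * sin (INR n * PI / (2 * INR N + 1)) ^ 2.

(* In the next five definitions dphi and ddphi stand for phi' and phi''. *)
Definition F_of (a : R) (f : R -> R -> R) (dphi ddphi : R -> R) (x t : R) : R :=
  f x t - dphi t - a * ddphi t.

Definition xi1_of (xi phi : R -> R) (x : R) : R := xi x - phi 0.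

Definition eta1_of (eta dphi : R -> R) (x : R) : R := eta x - dphi 0.

Definition Q_of (K z0 : R) (N : nat) (dphi : R -> R) (t : R) : R :=
  - sqrt (z0 / K)
  * (1 + sum_n_m (fun n => coef_a N n / coef_b N n) 1 N) * dphi t.

Definition R_of (dphi : R -> R) (t : R) : R := dphi t.

(* The support conditions refer to f, xi and eta extended by 0 outside their
   domains; continuity is only required on [0, xr] x [0, D] and [0, xr], so the
   extensions may jump across the boundary. *)
Record admissible_data (D xr : R) (f : R -> R -> R)
    (xi eta phi dphi ddphi dxi1 : R -> R) : Prop := {
  data_f_cont : continuous_on_rect xr D f;
  data_f_supp : forall x t : R, f x t <> 0 -> on_rect xr D (x, t);
  data_xi_cont : continuous_on (on_int 0 xr) xi;
  data_xi_supp : forall x : R, xi x <> 0 -> on_int 0 xr x;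
  data_eta_cont : continuous_on (on_int 0 xr) eta;
  data_eta_supp : forall x : R, eta x <> 0 -> on_int 0 xr x;
  data_phi_cont : continuous_on (on_int 0 D) phi;
  data_dphi : C1_on 0 D phi dphi;
  data_ddphi : C1_on 0 D dphi ddphi;
  data_dxi1 : C1_on 0 xr (xi1_of xi phi) dxi1
}.

(* Ttx and Ttxx are the first and second x-derivatives of Tt. *)
Record smooth_solution (D xr : R) (N : nat)
    (T Tt Ttt Tx Txx Ttx Ttxx : R -> R -> R)
    (zeta dzeta ddzeta : nat -> R -> R) : Prop := {
  sol_Tt : partial_t xr D T Tt;
  sol_Ttt : partial_t xr D Tt Ttt;
  sol_Tx : partial_x xr D T Tx;
  sol_Txx : partial_x xr D Tx Txx;
  sol_Ttx : partial_x xr D Tt Ttx;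
  sol_Ttxx : partial_x xr D Ttx Ttxx;
  sol_T_cont : continuous_on_rect xr D T;
  sol_Tt_cont : continuous_on_rect xr D Tt;
  sol_Ttt_cont : continuous_on_rect xr D Ttt;
  sol_Tx_cont : continuous_on_rect xr D Tx;
  sol_Txx_cont : continuous_on_rect xr D Txx;
  sol_Ttx_cont : continuous_on_rect xr D Ttx;
  sol_Ttxx_cont : continuous_on_rect xr D Ttxx;
  sol_dzeta : forall n : nat, (1 <= n <= N)%nat ->
    C1_on 0 D (zeta n) (dzeta n);
  sol_ddzeta : forall n : nat, (1 <= n <= N)%nat ->
    C1_on 0 D (dzeta n) (ddzeta n)
}.

Record reduced_problem (a b K D xr z0 : R) (N : nat)
    (F : R -> R -> R) (xi1 eta1 Q Rb : R -> R)
    (T Tt Ttt Tx Txx Ttx Ttxx : R -> R -> R)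
    (zeta dzeta ddzeta : nat -> R -> R) : Prop := {
  rp_pde : forall x t : R, 0 <= x <= xr -> 0 < t <= D ->
    Tt x t + a * Ttt x t = K * (Txx x t + b * Ttxx x t) + F x t;
  rp_init_T : forall x : R, 0 <= x <= xr -> T x 0 = xi1 x;
  rp_init_Tt : forall x : R, 0 <= x <= xr -> Tt x 0 = eta1 x;
  rp_left : forall t : R, 0 < t <= D -> T 0 t = 0;
  rp_right : forall t : R, 0 < t <= D ->
    Tx xr t + b * Ttx xr t
    + sqrt (z0 / K)
      * ((1 + sum_n_m (fun n => coef_a N n / coef_b N n) 1 N) * Tt xr t
         - z0 * sum_n_m (fun n => coef_a N n / coef_b N n * dzeta n t) 1 N)
    = Q t;
  rp_zeta : forall (n : nat) (t : R), (1 <= n <= N)%nat -> 0 < t <= D ->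
    (z0 - coef_b N n * z0) * dzeta n t
    + coef_b N n
      * (zeta n t + (a + b) * dzeta n t + a * b * ddzeta n t)
    = Tt xr t + Rb t;
  rp_init_zeta : forall n : nat, (1 <= n <= N)%nat -> zeta n 0 = 0;
  rp_init_dzeta : forall n : nat, (1 <= n <= N)%nat -> dzeta n 0 = 0
}.

(* Main.v *)
Require Import Defs.
From Stdlib Require Import Reals Lra Lia.
From Coquelicot Require Import Coquelicot.
Open Scope R_scope.

(** The estimate is an energy inequality. Write [v] for [T_t], [p] for [T_x],
    and put
      [E t = a / 2 * ||v||^2 + K / 2 * ||p||^2].
    Testing the equation with [v] and integrating by parts in [x] leaves the
    boundary power [K (p + b v_x)(xr) v(xr)], the source term [(F, v)] and
    dissipation: [- ||v||^2] absorbs [(F, v)] up to [||F||^2 / 2], and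
    [- K b ||v_x||^2] is dropped ([energy_flux_le]).

    The boundary condition turns the boundary power into a quadratic form in
    [u = v(xr)] and the [zeta_n'], of indefinite sign. It is compensated by the
    energy stored in the auxiliary variables,
      [sqrt (K z0) * sum_n z0 a_n / 2 * (zeta_n^2 + a b zeta_n'^2)],
    which starts at 0 and stays nonnegative. Since [1 - b_n] is a squared sine,
    [a_n = al (1 - b_n)] with [al = 2 / (2N + 1)], and with that weight each
    mode completes to a square:
      [(a_n / b_n) (u^2 - 2 z0 zeta_n' u + z0^2 (1 - b_n) zeta_n'^2)
       = (al / b_n) ((1 - b_n) z0 zeta_n' - u)^2 - al u^2].
    The [N] losses [al u^2] add up to [(1 - 1 / (2N + 1)) u^2], so exactly
    [u^2 / (2N + 1)] of the damping [u^2] survives; it absorbs [Q u] and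
    produces the factor [2N + 1] in front of [Q^2]. The terms [R zeta_n'] are
    absorbed by the damping with coefficient [a + b]
    ([memory_term_le], [boundary_power_le]).

    Integrating from 0 to [t] bounds [E t], hence [||T_x||^2]; since [T]
    vanishes at [x = 0], [||T||^2 <= xr^2 / 2 * ||T_x||^2]
    ([poincare_left_zero]).

    The energy is never differentiated in time: its increment is a space-time
    integral of products, obtained slice by slice and reordered by exchanging
    the two integrations ([energy_increment]). This needs [T_x] to be an
    antiderivative in [t] of the x-derivative of [T_t], which is proved from
    the existence of the other derivatives ([antideriv_on_mixed]). One-sided
    derivatives on closed intervals are handled by extending the continuous
    derivatives to the whole line, constantly beyond the end points, and
    integrating them back ([C1_on_antideriv_on]). *)

(** * Constant extension beyond an interval or a rectangle *)

Definition clamp (l u x : R) : R := Rmax l (Rmin x u).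

Lemma clamp_in (l u x : R) : l <= u -> on_int l u (clamp l u x).
Proof.
intros Hlu; unfold on_int, clamp, Rmax, Rmin.
destruct (Rle_dec x u); destruct (Rle_dec _ _); lra.
Qed.

Lemma clamp_id (l u x : R) : l <= x <= u -> clamp l u x = x.
Proof.
intros Hx; unfold clamp, Rmax, Rmin.
destruct (Rle_dec x u); destruct (Rle_dec _ _); lra.
Qed.

Lemma clamp_continuous (l u x : R) : continuous (clamp l u) x.
Proof.
apply filterlim_locally; intros eps; exists eps; intros y Hy.
change (Rabs (clamp l u y - clamp l u x) < eps).
change (Rabs (y - x) < eps) in Hy.
apply Rle_lt_trans with (2 := Hy).
unfold clamp, Rmax, Rmin.
destruct (Rle_dec x u); destruct (Rle_dec y u); repeat destruct (Rle_dec _ _);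
  apply Rabs_le; unfold Rabs; destruct (Rcase_abs _); lra.
Qed.

Lemma continuous_on_comp_continuous {S U V : UniformSpace} (E : U -> Prop)
    (c : S -> U) (f : U -> V) :
  (forall y, E (c y)) -> (forall y, continuous c y) -> continuous_on E f ->
  forall y, continuous (fun z => f (c z)) y.
Proof.
intros HE Hc Hf y.
apply (filterlim_comp _ _ _ c f _ (within E (locally (c y)))).
- intros P HP.
  generalize (Hc y _ HP); unfold filtermap; apply filter_imp; auto.
- apply Hf, HE.
Qed.

Lemma continuous_clamp_comp (l u : R) (f : R -> R) :
  l <= u -> continuous_on (on_int l u) f ->
  forall x, continuous (fun y => f (clamp l u y)) x.
Proof.
intros Hlu Hf.
apply (continuous_on_comp_continuous (on_int l u) (clamp l u) f).
- intros y; apply clamp_in, Hlu.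
- apply clamp_continuous.
- exact Hf.
Qed.

Lemma continuous_pair {U V W : UniformSpace} (f : U -> V) (g : U -> W) (x : U) :
  continuous f x -> continuous g x -> continuous (fun y => (f y, g y)) x.
Proof.
intros Hf Hg; apply (continuous_comp_2 f g (fun a b => (a, b))); try assumption.
apply (continuous_ext (fun z => z)); [intros []; reflexivity | apply continuous_id].
Qed.

Definition joint_cont (w : R -> R -> R) : Prop :=
  forall x t, continuity_2d_pt w x t.

Definition clamp2 (X D : R) (w : R -> R -> R) (x t : R) : R :=
  w (clamp 0 X x) (clamp 0 D t).

Lemma clamp2_id (X D : R) (w : R -> R -> R) (x t : R) :
  0 <= x <= X -> 0 <= t <= D -> clamp2 X D w x t = w x t.
Proof. intros Hx Ht; unfold clamp2; rewrite !clamp_id; auto. Qed.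

Lemma joint_cont_clamp2 (X D : R) (w : R -> R -> R) :
  0 <= X -> 0 <= D -> continuous_on_rect X D w -> joint_cont (clamp2 X D w).
Proof.
intros HX HD Hw x t; apply continuity_2d_pt_filterlim.
apply (continuous_on_comp_continuous (on_rect X D)
  (fun p : R * R => (clamp 0 X (fst p), clamp 0 D (snd p)))
  (fun p => w (fst p) (snd p))).
- intros y; split; apply clamp_in; assumption.
- intros y; apply continuous_pair.
  + apply (continuous_comp fst (clamp 0 X));
      [apply continuous_fst | apply clamp_continuous].
  + apply (continuous_comp snd (clamp 0 D));
      [apply continuous_snd | apply clamp_continuous].
- exact Hw.
Qed.

Lemma joint_cont_fix_t (w : R -> R -> R) (t : R) :
  joint_cont w -> forall x, continuous (fun y => w y t) x.
Proof.
intros Hw x.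
assert (H := proj1 (continuity_2d_pt_filterlim w x t) (Hw x t)).
apply (filterlim_comp _ _ _ (fun y => (y, t))
  (fun z : R * R => w (fst z) (snd z)) _ (locally (x, t))); [|exact H].
apply continuous_pair; [apply continuous_id | apply continuous_const].
Qed.

Lemma joint_cont_swap (w : R -> R -> R) : joint_cont w -> joint_cont (fun x y => w y x).
Proof.
intros Hw x y eps.
destruct (Hw y x eps) as [d Hd]; exists d; intros u v Hu Hv.
apply Hd; assumption.
Qed.

Lemma joint_cont_fix_x (w : R -> R -> R) (x : R) :
  joint_cont w -> forall t, continuous (w x) t.
Proof. intros Hw; apply (joint_cont_fix_t _ x (joint_cont_swap w Hw)). Qed.

Lemma joint_cont_plus (v w : R -> R -> R) :
  joint_cont v -> joint_cont w -> joint_cont (fun x t => v x t + w x t).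
Proof. intros Hv Hw x t; apply continuity_2d_pt_plus; auto. Qed.

Lemma joint_cont_mult (v w : R -> R -> R) :
  joint_cont v -> joint_cont w -> joint_cont (fun x t => v x t * w x t).
Proof. intros Hv Hw x t; apply continuity_2d_pt_mult; auto. Qed.

Lemma joint_cont_scal (c : R) (w : R -> R -> R) :
  joint_cont w -> joint_cont (fun x t => c * w x t).
Proof.
intros Hw; apply joint_cont_mult; [|exact Hw].
intros x t; apply continuity_2d_pt_const.
Qed.

(** * Integrals depending on a parameter *)

Lemma ex_RInt_cont (f : R -> R) (a b : R) :
  (forall x, continuous f x) -> ex_RInt f a b.
Proof. intros Hf; apply (@ex_RInt_continuous R_CompleteNormedModule); auto. Qed.

Lemma is_derive_RInt_cont (f : R -> R) (a x : R) :
  (forall y, continuous f y) -> is_derive (fun y => RInt f a y) x (f x).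
Proof.
intros Hf; apply (@is_derive_RInt R_NormedModule f (fun y => RInt f a y) a x).
- apply filter_forall; intros y.
  apply (@RInt_correct R_CompleteNormedModule), ex_RInt_cont, Hf.
- apply Hf.
Qed.

Lemma is_RInt_of_primitive (h dh : R -> R) (a b : R) :
  (forall x, is_derive h x (dh x)) -> (forall x, continuous dh x) ->
  is_RInt dh a b (h b - h a).
Proof.
intros H1 H2; apply (@is_RInt_derive R_CompleteNormedModule h dh a b); auto.
Qed.

(** Uniform continuity of [w] near the segment [[a, b] x {t}]. *)
Lemma RInt_param_continuous_le (w : R -> R -> R) (a b : R) :
  a <= b -> joint_cont w ->
  forall t, continuous (fun s => RInt (fun x => w x s) a b) t.
Proof.
intros Hab Hw t; apply filterlim_locally; intros eps.
assert (He : 0 < eps / (b - a + 1)).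
{ apply Rdiv_lt_0_compat; [apply cond_pos | lra]. }
destruct (uniform_continuity_2d_1d w a b t (fun x _ => Hw x t) (mkposreal _ He))
  as [d Hd]; simpl in Hd.
exists d; intros s Hs.
change (Rabs (s - t) < d) in Hs.
change (Rabs (RInt (fun x => w x s) a b - RInt (fun x => w x t) a b) < eps).
assert (Hi : forall r, ex_RInt (fun x => w x r) a b).
{ intros r; apply ex_RInt_cont, joint_cont_fix_t, Hw. }
replace (RInt (fun x => w x s) a b - RInt (fun x => w x t) a b)
  with (RInt (fun x => w x s - w x t) a b)
  by (apply (@RInt_minus R_CompleteNormedModule); apply Hi).
apply Rle_lt_trans with ((b - a) * (eps / (b - a + 1))).
- apply (abs_RInt_le_const (fun x => w x s - w x t)).
  + exact Hab.
  + apply (@ex_RInt_minus R_NormedModule); apply Hi.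
  + intros x Hx; apply Rlt_le, (Hd x t x s); try assumption.
    * assert (Hp := cond_pos d); lra.
    * apply Rabs_def2 in Hs; lra.
    * unfold Rminus; rewrite Rplus_opp_r, Rabs_R0; apply cond_pos.
- assert (Hp := cond_pos eps).
  apply Rlt_le_trans with ((b - a + 1) * (eps / (b - a + 1))).
  + apply Rmult_lt_compat_r; [exact He | lra].
  + right; field; lra.
Qed.

Lemma RInt_param_continuous (w : R -> R -> R) (a b : R) :
  joint_cont w -> forall t, continuous (fun s => RInt (fun x => w x s) a b) t.
Proof.
intros Hw t; destruct (Rle_dec a b) as [Hab | Hab].
- apply RInt_param_continuous_le; assumption.
- apply (continuous_ext (fun s => - RInt (fun x => w x s) b a)).
  + intros s; apply (@opp_RInt_swap R_CompleteNormedModule).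
    apply ex_RInt_cont, joint_cont_fix_t, Hw.
  + apply (@continuous_opp _ R_AbsRing R_NormedModule).
    apply RInt_param_continuous_le; [lra | exact Hw].
Qed.

(** Both sides vanish at [d = c] and have the same derivative in [d]: on the
    left one differentiates under the integral sign. *)
Lemma RInt_swap (w : R -> R -> R) (a b c d : R) :
  joint_cont w ->
  RInt (fun x => RInt (fun s => w x s) c d) a b
  = RInt (fun s => RInt (fun x => w x s) a b) c d.
Proof.
intros Hw.
assert (HD : forall x r, Derive (fun z => RInt (w x) c z) r = w x r).
{ intros x r; apply is_derive_unique, is_derive_RInt_cont, joint_cont_fix_x, Hw. }
assert (HH : forall r,
  is_derive (fun r => RInt (fun x => RInt (w x) c r) a b) r
            (RInt (fun x => w x r) a b)).
{ intros r.
  rewrite (RInt_ext (fun x => w x r)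
             (fun x => Derive (fun z => RInt (w x) c z) r))
    by (intros; symmetry; apply HD).
  apply (is_derive_RInt_param (fun r x => RInt (w x) c r)).
  - apply filter_forall; intros z x _; exists (w x z).
    apply is_derive_RInt_cont, joint_cont_fix_x, Hw.
  - intros x _; apply (continuity_2d_pt_ext (fun u v => w v u)).
    + intros u v; symmetry; apply HD.
    + apply joint_cont_swap, Hw.
  - apply filter_forall; intros z; apply ex_RInt_cont.
    apply (RInt_param_continuous (fun u v => w v u)), joint_cont_swap, Hw. }
symmetry; apply is_RInt_unique.
replace (RInt (fun x => RInt (fun s => w x s) c d) a b)
  with (RInt (fun x => RInt (w x) c d) a b - RInt (fun x => RInt (w x) c c) a b).
- apply (is_RInt_of_primitive (fun r => RInt (fun x => RInt (w x) c r) a b)); auto.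
  apply RInt_param_continuous, Hw.
- rewrite (RInt_ext (fun x => RInt (w x) c c) (fun _ => 0)).
  + rewrite RInt_const; unfold scal; simpl; unfold mult; simpl.
    change (fun x => RInt (w x) c d) with (fun x => RInt (fun s => w x s) c d); ring.
  + intros x _; apply (@RInt_point R_CompleteNormedModule).
Qed.

(** * Antiderivatives on a closed interval *)

(** The values of [g] off [[l, u]] are irrelevant while [dg] is a function on
    the whole line: the witness [h] has two-sided derivatives even at [l] and
    [u], where [g] need not. *)
Definition antideriv_on (l u : R) (g dg : R -> R) : Prop :=
  exists h : R -> R, (forall x, is_derive h x (dg x))
    /\ (forall x, l <= x <= u -> h x = g x).

Lemma deriv_on_continuous_on (l u : R) (g dg : R -> R) :
  deriv_on l u g dg -> continuous_on (on_int l u) g.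
Proof.
intros Hg x Hx; apply filterlim_locally; intros eps.
destruct (cont_deriv g dg _ x (Hg x Hx) eps (cond_pos eps)) as [d [Hd H]].
exists (mkposreal d Hd); intros y Hy Hyin.
destruct (Req_dec y x) as [-> | Hne]; [apply ball_center|].
apply (H y); split; [split; [exact Hyin | auto] | exact Hy].
Qed.

Lemma deriv_on_is_derive (l u : R) (g dg : R -> R) (x : R) :
  deriv_on l u g dg -> l < x < u -> is_derive g x (dg x).
Proof.
intros Hg Hx; apply is_derive_Reals; intros eps Heps.
destruct (Hg x ltac:(unfold on_int; lra) eps Heps) as [d [Hd H]].
assert (Hm : 0 < Rmin d (Rmin (x - l) (u - x)))
  by (repeat apply Rmin_pos; lra).
exists (mkposreal _ Hm); simpl; intros h Hh0 Hh.
assert (H1 := Rmin_l d (Rmin (x - l) (u - x))).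
assert (H2 := Rmin_r d (Rmin (x - l) (u - x))).
assert (H3 := Rmin_l (x - l) (u - x)).
assert (H4 := Rmin_r (x - l) (u - x)).
assert (Hh' := Rabs_def2 _ _ Hh).
assert (HH := H (x + h)); simpl in HH; unfold Rdist in HH.
replace (x + h - x) with h in HH by ring.
apply HH; split; [|lra].
split; [unfold on_int; lra | lra].
Qed.

(** The witness is [g l] plus the integral of the extended derivative. It
    differs from [g] by a function continuous on [[l, u]] with zero derivative
    inside, hence by a constant, which is 0. *)
Lemma C1_on_antideriv_on (l u : R) (g dg : R -> R) :
  l <= u -> C1_on l u g dg ->
  antideriv_on l u g (fun x => dg (clamp l u x)).
Proof.
intros Hlu [Hg Hdg].
set (dh := fun x => dg (clamp l u x)).
assert (Hdh : forall x, continuous dh x)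
  by (apply continuous_clamp_comp; assumption).
assert (Hgc : forall x, continuous (fun y => g (clamp l u y)) x)
  by (apply continuous_clamp_comp;
      [assumption | apply (deriv_on_continuous_on _ _ _ dg Hg)]).
set (h := fun x => g l + RInt dh l x).
assert (Hh : forall x, is_derive h x (dh x)).
{ intros x; replace (dh x) with (plus 0 (dh x)) by apply Rplus_0_l.
  apply (@is_derive_plus R_AbsRing R_NormedModule (fun _ => g l)).
  - apply (@is_derive_const R_AbsRing R_NormedModule).
  - apply is_derive_RInt_cont, Hdh. }
exists h; split; [exact Hh|].
intros x Hx.
destruct (MVT_gen (fun y => h y - g (clamp l u y)) l x (fun _ => 0)) as [c [_ Hc]].
- intros y; rewrite Rmin_left, Rmax_right by lra; intros Hy.
  replace 0 with (minus (dh y) (dg y))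
    by (unfold dh; rewrite clamp_id by lra; apply (@minus_eq_zero R_AbelianGroup)).
  apply (@is_derive_minus R_AbsRing R_NormedModule h
    (fun z => g (clamp l u z)) y (dh y) (dg y)); [apply Hh|].
  apply (is_derive_ext_loc g (fun z => g (clamp l u z))).
  + assert (Hlt : locally y (fun z => l < z < u)).
    { apply (open_and (fun z => l < z) (fun z => z < u));
        [apply open_gt | apply open_lt | lra]. }
    apply filter_imp with (2 := Hlt); intros z Hz; rewrite clamp_id by lra; reflexivity.
  + apply (deriv_on_is_derive l u); [exact Hg | lra].
- intros y _; apply continuity_pt_filterlim.
  apply (@continuous_minus _ R_AbsRing R_NormedModule h (fun z => g (clamp l u z))).
  + apply (@ex_derive_continuous R_AbsRing R_NormedModule); exists (dh y); apply Hh.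
  + apply Hgc.
- rewrite !clamp_id in Hc by lra.
  assert (Hl : h l = g l).
  { unfold h; rewrite (@RInt_point R_CompleteNormedModule); apply Rplus_0_r. }
  lra.
Qed.

Lemma antideriv_on_ext (l u : R) (g g' dg : R -> R) :
  (forall x, l <= x <= u -> g x = g' x) ->
  antideriv_on l u g dg -> antideriv_on l u g' dg.
Proof.
intros He [h [H1 H2]]; exists h; split; [exact H1|].
intros x Hx; rewrite H2, He; auto.
Qed.

Lemma antideriv_on_is_RInt (l u : R) (g dg : R -> R) (x y : R) :
  (forall z, continuous dg z) -> antideriv_on l u g dg ->
  l <= x <= u -> l <= y <= u -> is_RInt dg x y (g y - g x).
Proof.
intros Hc [h [H1 H2]] Hx Hy; rewrite <- !H2 by assumption.
apply is_RInt_of_primitive; assumption.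
Qed.

(** The end points are excluded: a one-point interval would allow any two
    derivatives. *)
Lemma antideriv_on_unique (l u : R) (g dg1 dg2 : R -> R) :
  antideriv_on l u g dg1 -> antideriv_on l u g dg2 ->
  forall x, l < x < u -> dg1 x = dg2 x.
Proof.
intros [h1 [H1 E1]] [h2 [H2 E2]] x Hx.
rewrite <- (is_derive_unique _ _ _ (H2 x)).
symmetry; apply is_derive_unique.
apply (is_derive_ext_loc h1); [|apply H1].
assert (Hlt : locally x (fun z => l < z < u)).
{ apply (open_and (fun z => l < z) (fun z => z < u));
    [apply open_gt | apply open_lt | lra]. }
apply filter_imp with (2 := Hlt); intros z Hz; rewrite E1, E2 by lra; reflexivity.
Qed.

(** The product rule formula for [d] holds only on [[l, u]], because off that
    interval the antiderivatives differ from [f] and [g]. *)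
Lemma antideriv_on_mult (l u : R) (f df g dg : R -> R) :
  antideriv_on l u f df -> antideriv_on l u g dg ->
  exists d, antideriv_on l u (fun x => f x * g x) d /\
  ((forall x, continuous df x) -> (forall x, continuous dg x) ->
    forall x, continuous d x) /\
  forall x, l <= x <= u -> d x = df x * g x + f x * dg x.
Proof.
intros [h [H1 E1]] [k [H2 E2]].
exists (fun x => df x * k x + h x * dg x).
assert (Ch : forall x, continuous h x)
  by (intros x; apply (@ex_derive_continuous R_AbsRing R_NormedModule);
      exists (df x); apply H1).
assert (Ck : forall x, continuous k x)
  by (intros x; apply (@ex_derive_continuous R_AbsRing R_NormedModule);
      exists (dg x); apply H2).
split; [|split].
- exists (fun x => h x * k x); split.
  + intros x; apply (@is_derive_mult R_AbsRing);
      [apply H1 | apply H2 | intros; apply Rmult_comm].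
  + intros x Hx; rewrite E1, E2 by assumption; reflexivity.
- intros C1 C2 x; apply (@continuous_plus _ R_AbsRing R_NormedModule);
    apply (@continuous_mult _ R_AbsRing); auto.
- intros x Hx; rewrite E1, E2 by assumption; reflexivity.
Qed.

Lemma is_RInt_mult_deriv (l u : R) (f df g dg : R -> R) (x y : R) :
  (forall z, continuous df z) -> (forall z, continuous dg z) ->
  antideriv_on l u f df -> antideriv_on l u g dg ->
  l <= x <= y -> y <= u ->
  is_RInt (fun z => df z * g z + f z * dg z) x y (f y * g y - f x * g x).
Proof.
intros C1 C2 Hf Hg Hx Hy.
destruct (antideriv_on_mult _ _ _ _ _ _ Hf Hg) as [d [Hd [Hc He]]].
apply (is_RInt_ext d).
- intros z; rewrite Rmin_left, Rmax_right by lra; intros Hz; apply He; lra.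
- apply (antideriv_on_is_RInt l u (fun z => f z * g z)); auto; lra.
Qed.

(** A form of Schwarz's theorem that does not presuppose that [ux] can be
    differentiated in [t]. As functions of [r], the double integral of [utx]
    over [[0, r] x [0, t]] and the increment [u r t - u 0 t - u r 0 + u 0 0]
    coincide; comparing their r-derivatives gives
    [ux r t - ux r 0 = RInt (utx r) 0 t]. *)
Lemma antideriv_on_mixed (X D : R) (u ut ux utx : R -> R -> R) :
  0 <= D -> joint_cont ut -> joint_cont ux -> joint_cont utx ->
  (forall x, 0 <= x <= X -> antideriv_on 0 D (u x) (ut x)) ->
  (forall t, 0 <= t <= D -> antideriv_on 0 X (fun x => u x t) (fun x => ux x t)) ->
  (forall t, 0 <= t <= D -> antideriv_on 0 X (fun x => ut x t) (fun x => utx x t)) ->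
  forall x, 0 < x < X -> antideriv_on 0 D (ux x) (utx x).
Proof.
intros HD Cut Cux Cutx Hut Hux Hutx x Hx.
exists (fun s => ux x 0 + RInt (utx x) 0 s); split.
- intros s; replace (utx x s) with (plus 0 (utx x s)) by apply Rplus_0_l.
  apply (@is_derive_plus R_AbsRing R_NormedModule (fun _ => ux x 0)).
  + apply (@is_derive_const R_AbsRing R_NormedModule).
  + apply is_derive_RInt_cont, joint_cont_fix_x, Cutx.
- intros t Ht.
  assert (H : forall r, 0 < r < X -> RInt (utx r) 0 t = ux r t - ux r 0);
    [|rewrite H by exact Hx; ring].
  apply (antideriv_on_unique 0 X (fun r => (u r t - u 0 t) - (u r 0 - u 0 0))).
  + exists (fun r => RInt (fun x => RInt (utx x) 0 t) 0 r); split.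
    * intros r; apply (is_derive_RInt_cont (fun x => RInt (utx x) 0 t)).
      apply (RInt_param_continuous (fun u v => utx v u)), joint_cont_swap, Cutx.
    * intros r Hr.
      etransitivity; [apply (RInt_swap utx), Cutx|].
      transitivity (RInt (fun s => ut r s - ut 0 s) 0 t).
      { apply RInt_ext; intros s; rewrite Rmin_left, Rmax_right by lra; intros Hs.
        apply is_RInt_unique.
        apply (antideriv_on_is_RInt 0 X (fun x => ut x s)).
        - apply joint_cont_fix_t, Cutx.
        - apply Hutx; lra.
        - lra.
        - lra. }
      apply is_RInt_unique.
      replace (u r t - u 0 t - (u r 0 - u 0 0))
        with (minus (u r t - u r 0) (u 0 t - u 0 0))
        by (unfold minus, plus, opp; simpl; ring).
      apply (@is_RInt_minus R_NormedModule);
        (eapply antideriv_on_is_RInt;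
           [apply joint_cont_fix_x, Cut | apply Hut; lra | lra | lra]).
  + destruct (Hux t Ht) as [h [H1 E1]]; destruct (Hux 0 ltac:(lra)) as [k [H2 E2]].
    exists (fun r => (h r - u 0 t) - (k r - u 0 0)); split.
    * intros r; auto_derive.
      -- split; [eexists; apply H1 | split; [eexists; apply H2 | exact I]].
      -- assert (D1 := is_derive_unique _ _ _ (H1 r)).
         assert (D2 := is_derive_unique _ _ _ (H2 r)).
         change (1 * Derive h r + - (1 * Derive k r) = ux r t - ux r 0).
         rewrite D1, D2; ring.
    * intros r Hr; rewrite E1, E2 by lra; reflexivity.
Qed.

(** * Square integrals: evolution in time and the Poincare inequality *)

Lemma RInt_square_increment (X D : R) (u ut : R -> R -> R) (t : R) :
  0 <= X -> 0 <= t <= D -> joint_cont u -> joint_cont ut ->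
  (forall x, 0 < x < X -> antideriv_on 0 D (u x) (ut x)) ->
  RInt (fun x => u x t ^ 2) 0 X - RInt (fun x => u x 0 ^ 2) 0 X
  = RInt (fun s => RInt (fun x => 2 * (u x s * ut x s)) 0 X) 0 t.
Proof.
intros HX Ht Cu Cut Hu.
assert (Cw : joint_cont (fun x s => 2 * (u x s * ut x s)))
  by (apply (joint_cont_scal 2 (fun x s => u x s * ut x s)), joint_cont_mult;
      assumption).
assert (Csq : forall s, ex_RInt (fun x => u x s ^ 2) 0 X).
{ intros s; apply ex_RInt_cont; intros x.
  apply (continuous_ext (fun x => u x s * u x s)); [intros; simpl; ring|].
  apply (joint_cont_fix_t (fun x s => u x s * u x s)), joint_cont_mult; assumption. }
rewrite <- (RInt_swap (fun x s => 2 * (u x s * ut x s))) by exact Cw.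
transitivity (RInt (fun x => u x t ^ 2 - u x 0 ^ 2) 0 X);
  [symmetry; apply (@RInt_minus R_CompleteNormedModule); apply Csq|].
apply RInt_ext; intros x; rewrite Rmin_left, Rmax_right by lra; intros Hx.
symmetry; apply is_RInt_unique.
replace (u x t ^ 2 - u x 0 ^ 2) with (u x t * u x t - u x 0 * u x 0) by ring.
apply (is_RInt_ext (fun s => ut x s * u x s + u x s * ut x s)); [intros; simpl; ring|].
apply (is_RInt_mult_deriv 0 D); try (apply joint_cont_fix_x; assumption); auto; lra.
Qed.

(** Cauchy-Schwarz gives [g x ^ 2 <= x * J], where [J] is the integral of
    [dg^2]; integrating [x] over [[0, X]] yields the factor [X ^ 2 / 2]. *)
Lemma poincare_left_zero (X : R) (g dg : R -> R) :
  0 <= X -> (forall x, continuous dg x) -> antideriv_on 0 X g dg -> g 0 = 0 ->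
  RInt (fun x => g x ^ 2) 0 X <= X ^ 2 / 2 * RInt (fun x => dg x ^ 2) 0 X.
Proof.
intros HX Hc Hg H0.
assert (Csq : forall a b, ex_RInt (fun x => dg x ^ 2) a b).
{ intros; apply ex_RInt_cont; intros x.
  apply (continuous_ext (fun x => dg x * dg x)); [intros; simpl; ring|].
  apply (@continuous_mult _ R_AbsRing); apply Hc. }
set (J := RInt (fun x => dg x ^ 2) 0 X).
assert (HP : forall x, 0 < x < X -> g x ^ 2 <= x * J).
{ intros x Hx.
  (* Cauchy-Schwarz: expand the integral of (dg - m)^2, m the mean of dg. *)
  set (m := g x / x).
  assert (Hi : is_RInt (fun y => (dg y - m) ^ 2) 0 x
     (RInt (fun y => dg y ^ 2) 0 x - 2 * m * g x + x * m ^ 2)).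
  { apply (is_RInt_ext
      (fun y => plus (plus (dg y ^ 2) (scal (- (2 * m)) (dg y))) (m ^ 2)));
      [intros; unfold plus, scal; simpl; unfold mult; simpl; ring|].
    replace (RInt (fun y => dg y ^ 2) 0 x - 2 * m * g x + x * m ^ 2)
      with (plus (plus (RInt (fun y => dg y ^ 2) 0 x)
                       (scal (- (2 * m)) (g x - g 0)))
                 (scal (x - 0) (m ^ 2)))
      by (rewrite H0; unfold plus, scal; simpl; unfold mult; simpl; ring).
    apply (@is_RInt_plus R_NormedModule); [apply (@is_RInt_plus R_NormedModule)|].
    - apply (@RInt_correct R_CompleteNormedModule), Csq.
    - apply (@is_RInt_scal R_NormedModule), (antideriv_on_is_RInt 0 X g dg); auto; lra.
    - apply (@is_RInt_const R_NormedModule). }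
  assert (Hge : 0 <= RInt (fun y => (dg y - m) ^ 2) 0 x).
  { apply RInt_ge_0; [lra | eexists; exact Hi | intros; apply pow2_ge_0]. }
  rewrite (is_RInt_unique _ _ _ _ Hi) in Hge.
  assert (HJ : RInt (fun y => dg y ^ 2) 0 x <= J).
  { unfold J; rewrite <- (@RInt_Chasles R_CompleteNormedModule _ 0 x X) by apply Csq.
    assert (0 <= RInt (fun y => dg y ^ 2) x X)
      by (apply RInt_ge_0; [lra | apply Csq | intros; apply pow2_ge_0]).
    match goal with |- _ <= plus ?A ?B => change (plus A B) with (A + B) end; lra. }
  assert (Hm : g x = m * x) by (unfold m; field; lra).
  rewrite Hm in *; nra. }
assert (HI : is_RInt (fun x => x * J) 0 X (X ^ 2 / 2 * J)).
{ replace (X ^ 2 / 2 * J) with (X ^ 2 / 2 * J - 0 ^ 2 / 2 * J) by field.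
  apply (is_RInt_of_primitive (fun x => x ^ 2 / 2 * J)).
  - intros x; auto_derive; [exact I | field].
  - intros x; apply (@continuous_mult _ R_AbsRing);
      [apply continuous_id | apply continuous_const]. }
rewrite <- (is_RInt_unique _ _ _ _ HI).
apply RInt_le; [exact HX | | eexists; exact HI | exact HP].
destruct Hg as [h [H1 E1]].
apply (ex_RInt_ext (fun x => h x ^ 2)).
- intros x; rewrite Rmin_left, Rmax_right by lra; intros Hx; rewrite E1 by lra; reflexivity.
- apply ex_RInt_cont; intros x.
  apply (@ex_derive_continuous R_AbsRing R_NormedModule); auto_derive; eexists; apply H1.
Qed.

(** * Power balance at a fixed time *)

(** Here [v], [vt], [p], [q] are the slices of [T_t], [T_tt], [T_x], [T_tx].
    The left side is the rate of change of the energy. Replacing [a * vt] by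
    means of the equation gives [K] times the derivative of
    [(p + b * q) * v], minus [K * b * q^2], plus [F * v - v^2 <= F^2 / 2]. *)
Lemma energy_flux_le (X a b K : R) (v vt p px q qx F : R -> R) :
  0 <= X -> 0 <= b -> 0 <= K ->
  (forall x, continuous v x) -> (forall x, continuous vt x) ->
  (forall x, continuous p x) -> (forall x, continuous px x) ->
  (forall x, continuous q x) -> (forall x, continuous qx x) ->
  antideriv_on 0 X v q -> antideriv_on 0 X p px -> antideriv_on 0 X q qx ->
  v 0 = 0 ->
  (forall x, 0 <= x <= X -> v x + a * vt x = K * (px x + b * qx x) + F x) ->
  RInt (fun x => a * (v x * vt x) + K * (p x * q x)) 0 X
  <= K * ((p X + b * q X) * v X) + / 2 * RInt (fun x => F x ^ 2) 0 X.
Proof.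
intros HX Hb HK Cv Cvt Cp Cpx Cq Cqx Hv Hp Hq H0 Hpde.
assert (HF : ex_RInt (fun x => F x ^ 2) 0 X).
{ apply (ex_RInt_ext (fun x => (v x + a * vt x - K * (px x + b * qx x)) ^ 2)).
  - intros x; rewrite Rmin_left, Rmax_right by lra; intros Hx.
    f_equal; rewrite Hpde by lra; ring.
  - apply ex_RInt_cont; intros x.
    apply (continuous_ext (fun x => (v x + a * vt x - K * (px x + b * qx x))
                              * (v x + a * vt x - K * (px x + b * qx x))));
      [intros; simpl; ring|].
    assert (C : continuous (fun x => v x + a * vt x - K * (px x + b * qx x)) x).
    { apply (@continuous_minus _ R_AbsRing R_NormedModule (fun x => v x + a * vt x)).
      - apply (@continuous_plus _ R_AbsRing R_NormedModule v); [apply Cv|].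
        apply (@continuous_scal_r _ R_AbsRing R_NormedModule a vt), Cvt.
      - apply (@continuous_scal_r _ R_AbsRing R_NormedModule K (fun x => px x + b * qx x)).
        apply (@continuous_plus _ R_AbsRing R_NormedModule px); [apply Cpx|].
        apply (@continuous_scal_r _ R_AbsRing R_NormedModule b qx), Cqx. }
    apply (@continuous_mult _ R_AbsRing); exact C. }
assert (Hpq : is_RInt
  (fun x => K * (px x * v x + p x * q x) + K * b * (qx x * v x + q x * q x)
            + / 2 * F x ^ 2) 0 X
  (K * ((p X + b * q X) * v X) + / 2 * RInt (fun x => F x ^ 2) 0 X)).
{ replace (K * ((p X + b * q X) * v X) + / 2 * RInt (fun x => F x ^ 2) 0 X)
    with (plus (plus (scal K (p X * v X - p 0 * v 0))
                     (scal (K * b) (q X * v X - q 0 * v 0)))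
               (scal (/ 2) (RInt (fun x => F x ^ 2) 0 X)))
    by (rewrite H0; unfold plus, scal; simpl; unfold mult; simpl; ring).
  apply (@is_RInt_plus R_NormedModule); [apply (@is_RInt_plus R_NormedModule)|];
    apply (@is_RInt_scal R_NormedModule).
  - apply (is_RInt_mult_deriv 0 X); auto; lra.
  - apply (is_RInt_mult_deriv 0 X); auto; lra.
  - apply (@RInt_correct R_CompleteNormedModule), HF. }
rewrite <- (is_RInt_unique _ _ _ _ Hpq).
apply RInt_le; [exact HX | | eexists; exact Hpq |].
- apply ex_RInt_cont; intros x.
  apply (@continuous_plus _ R_AbsRing R_NormedModule (fun x => a * (v x * vt x)));
    [apply (@continuous_scal_r _ R_AbsRing R_NormedModule a (fun x => v x * vt x))
    |apply (@continuous_scal_r _ R_AbsRing R_NormedModule K (fun x => p x * q x))];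
    apply (@continuous_mult _ R_AbsRing); auto.
- intros x Hx; specialize (Hpde x ltac:(lra)).
  replace (a * (v x * vt x)) with ((a * vt x) * v x) by ring.
  replace (a * vt x) with (K * (px x + b * qx x) + F x - v x) by lra.
  assert (0 <= K * b * (q x * q x))
    by (apply Rmult_le_pos; [apply Rmult_le_pos; lra | nra]).
  assert (0 <= (v x - / 2 * F x) ^ 2) by (apply pow2_ge_0).
  assert (0 <= F x ^ 2) by (apply pow2_ge_0).
  nra.
Qed.

(** * Finite sums *)

Lemma sum_n_m_le_loc (u v : nat -> R) (p q : nat) :
  (forall n, (p <= n <= q)%nat -> u n <= v n) ->
  sum_n_m u p q <= sum_n_m v p q.
Proof.
intros H.
set (cut := fun (w : nat -> R) n =>
  if andb (p <=? n)%nat (n <=? q)%nat then w n else 0).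
assert (E : forall w, sum_n_m w p q = sum_n_m (cut w) p q).
{ intros w; apply sum_n_m_ext_loc; intros n Hn; unfold cut.
  rewrite (proj2 (Nat.leb_le p n)), (proj2 (Nat.leb_le n q)) by lia; reflexivity. }
rewrite (E u), (E v); apply sum_n_m_le; intros n; unfold cut.
destruct (Nat.leb_spec p n); destruct (Nat.leb_spec n q); simpl; try lra.
apply H; lia.
Qed.

Lemma is_RInt_sum_n_m (f : nat -> R -> R) (I : nat -> R) (a b : R) (p q : nat) :
  (forall n, (p <= n <= q)%nat -> is_RInt (f n) a b (I n)) ->
  is_RInt (fun s => sum_n_m (fun n => f n s) p q) a b (sum_n_m I p q).
Proof.
assert (Z : forall q, (q < p)%nat ->
  is_RInt (fun s => sum_n_m (fun n => f n s) p q) a b (sum_n_m I p q)).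
{ intros m Hm; rewrite sum_n_m_zero by exact Hm.
  apply (is_RInt_ext (fun _ => 0)).
  - intros s _; rewrite sum_n_m_zero by exact Hm; reflexivity.
  - replace (zero : R) with (scal (b - a) 0)
      by (unfold scal; simpl; unfold mult; simpl; apply Rmult_0_r).
    apply (@is_RInt_const R_NormedModule). }
induction q as [|q IH]; intros H.
- destruct p as [|p]; [|apply Z; lia].
  rewrite sum_n_n; apply (is_RInt_ext (f 0%nat)); [|apply H; lia].
  intros; rewrite sum_n_n; reflexivity.
- destruct (Nat.le_gt_cases p (S q)) as [Hle | Hgt]; [|apply Z, Hgt].
  rewrite sum_n_Sm by exact Hle.
  apply (is_RInt_ext (fun s => plus (sum_n_m (fun n => f n s) p q) (f (S q) s))).
  + intros s _; rewrite sum_n_Sm by exact Hle; reflexivity.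
  + apply (@is_RInt_plus R_NormedModule); [apply IH; intros; apply H; lia | apply H; lia].
Qed.

(** * Boundary power and memory variables *)

(** The angle is below [PI / 2] because [2 n < 2 N + 1]. *)
Lemma coef_b_pos (N n : nat) : (1 <= n <= N)%nat -> 0 < coef_b N n.
Proof.
intros Hn; unfold coef_b; apply pow_lt, cos_gt_0.
- assert (H := PI_RGT_0).
  assert (0 <= INR n) by apply pos_INR; assert (0 <= INR N) by apply pos_INR.
  apply Rlt_le_trans with 0; [lra|].
  apply Rmult_le_pos; [apply Rmult_le_pos; lra | left; apply Rinv_0_lt_compat; lra].
- assert (H := PI_RGT_0).
  assert (INR n <= INR N) by (apply le_INR; lia); assert (0 <= INR N) by apply pos_INR.
  apply (Rmult_lt_reg_r (2 * INR N + 1)); [lra|].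
  replace (INR n * PI / (2 * INR N + 1) * (2 * INR N + 1)) with (INR n * PI) by (field; lra).
  nra.
Qed.

Lemma coef_b_le_1 (N n : nat) : coef_b N n <= 1.
Proof.
unfold coef_b; assert (H := COS_bound (INR n * PI / (2 * INR N + 1))); nra.
Qed.

Lemma coef_a_eq (N n : nat) :
  coef_a N n = 2 / (2 * INR N + 1) * (1 - coef_b N n).
Proof.
unfold coef_a, coef_b; f_equal.
set (x := INR n * PI / (2 * INR N + 1)).
assert (H := sin2_cos2 x); unfold Rsqr in H; nra.
Qed.

(** One mode of the boundary form, with [al * (1 - be)] in the role of [a_n] and
    [v] in that of [zeta_n']; the term [z0 * (al * (1 - be)) * (v * w)] is the
    power stored in the mode. The gap between the two sides is the sum of two
    squares: one completes the form in [(u, v)], the other absorbs [v * r] in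
    the damping [c * v^2]. *)
Lemma memory_term_le (al be z0 c u v r w : R) :
  0 <= al -> 0 < be <= 1 -> 0 < z0 -> 0 < c ->
  z0 * (1 - be) * v + be * (w + c * v) = u + r ->
  - (al * (1 - be) / be) * u ^ 2 + z0 * (al * (1 - be) / be) * (v * u)
    + z0 * (al * (1 - be)) * (v * w)
  <= al * u ^ 2 + z0 / (4 * c) * (al * (1 - be) / be ^ 2 * r ^ 2).
Proof.
intros Hal Hbe Hz Hc Hv.
assert (Hw : w = (u + r - z0 * (1 - be) * v) / be - c * v)
  by (apply (Rmult_eq_reg_l be); [field_simplify; lra | lra]).
assert (H1 : 0 <= al / be * ((1 - be) * z0 * v - u) ^ 2).
{ apply Rmult_le_pos; [apply Rdiv_le_0_compat; lra | apply pow2_ge_0]. }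
assert (H2 : 0 <= z0 * al * (1 - be) * c * (v - r / (2 * be * c)) ^ 2).
{ apply Rmult_le_pos; [|apply pow2_ge_0].
  repeat apply Rmult_le_pos; lra. }
apply Rminus_le_0.
match goal with |- 0 <= ?X =>
  replace X with (al / be * ((1 - be) * z0 * v - u) ^ 2
    + z0 * al * (1 - be) * c * (v - r / (2 * be * c)) ^ 2) end.
- lra.
- rewrite Hw; field; lra.
Qed.

(** [V] stands for [T_x + b T_tx] at [xr], [v n] for [zeta_n'] and [w n] for
    [zeta_n + a b zeta_n'']. Summing [memory_term_le] over the modes costs
    [N * (2 / (2N + 1)) = 1 - 1 / (2N + 1)] of the damping [u^2]. *)
Lemma boundary_power_le (a b K z0 : R) (N : nat) (Q r u V : R) (v w : nat -> R) :
  0 < a + b -> 0 < K -> 0 < z0 ->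
  V + sqrt (z0 / K) * ((1 + sum_n_m (fun n => coef_a N n / coef_b N n) 1 N) * u
         - z0 * sum_n_m (fun n => coef_a N n / coef_b N n * v n) 1 N) = Q ->
  (forall n, (1 <= n <= N)%nat ->
     (z0 - coef_b N n * z0) * v n + coef_b N n * (w n + (a + b) * v n) = u + r) ->
  K * (V * u) + sqrt (K * z0) * sum_n_m (fun n => z0 * coef_a N n * (v n * w n)) 1 N
  <= K * sqrt K * (2 * INR N + 1) / (4 * sqrt z0) * Q ^ 2
     + sqrt K * (z0 * sqrt z0) / (4 * (a + b))
       * sum_n_m (fun n => coef_a N n / coef_b N n ^ 2 * r ^ 2) 1 N.
Proof.
intros Hab HK Hz HV Hv.
set (m := 2 * INR N + 1).
assert (Hm : 0 < m) by (unfold m; assert (H := pos_INR N); lra).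
assert (Hsum :
  - (sum_n_m (fun n => coef_a N n / coef_b N n) 1 N) * u ^ 2
  + z0 * sum_n_m (fun n => coef_a N n / coef_b N n * v n) 1 N * u
  + sum_n_m (fun n => z0 * coef_a N n * (v n * w n)) 1 N
  <= (1 - / m) * u ^ 2
     + z0 / (4 * (a + b)) * sum_n_m (fun n => coef_a N n / coef_b N n ^ 2 * r ^ 2) 1 N).
{ assert (L : forall c (f : nat -> R),
      c * sum_n_m f 1 N = sum_n_m (fun n => c * f n) 1 N)
    by (intros; symmetry; apply (@sum_n_m_mult_l R_Ring)).
  assert (P : forall f g : nat -> R,
      sum_n_m f 1 N + sum_n_m g 1 N = sum_n_m (fun n => f n + g n) 1 N)
    by (intros; symmetry; apply (@sum_n_m_plus R_AbelianMonoid)).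
  assert (C : sum_n_m (fun _ => 2 / m) 1 N = 1 - / m).
  { rewrite sum_n_m_const; replace (S N - 1)%nat with N by lia.
    change (INR N * (2 / m) = 1 - / m); unfold m; field; unfold m in Hm; lra. }
  rewrite <- C.
  match goal with |- - ?A * ?B + ?C * ?D * ?E + ?F <= ?G * ?B + ?H =>
    replace (- A * B + C * D * E + F) with ((- B) * A + (C * E) * D + F) by ring;
    rewrite (Rmult_comm G B) end.
  rewrite !L, !P.
  apply sum_n_m_le_loc; intros n Hn.
  assert (Hb := coef_b_pos N n Hn); assert (Hb1 := coef_b_le_1 N n).
  assert (H := memory_term_le (2 / m) (coef_b N n) z0 (a + b) u (v n) r (w n)).
  rewrite coef_a_eq; fold m.
  assert (0 < 2 / m) by (apply Rdiv_lt_0_compat; lra).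
  specialize (Hv n Hn).
  specialize (H ltac:(lra) ltac:(lra) Hz Hab ltac:(lra)); lra. }
set (S1 := sum_n_m (fun n => coef_a N n / coef_b N n) 1 N) in *.
set (S2 := sum_n_m (fun n => coef_a N n / coef_b N n * v n) 1 N) in *.
set (S3 := sum_n_m (fun n => z0 * coef_a N n * (v n * w n)) 1 N) in *.
set (S4 := sum_n_m (fun n => coef_a N n / coef_b N n ^ 2 * r ^ 2) 1 N) in *.
assert (Hk := sqrt_lt_R0 K HK); assert (Hy := sqrt_lt_R0 z0 Hz).
rewrite sqrt_mult by lra; rewrite sqrt_div_alt in HV by lra.
set (k := sqrt K) in *; set (y := sqrt z0) in *.
assert (EK : K = k * k) by (symmetry; apply sqrt_sqrt; lra).
assert (Ez : z0 = y * y) by (symmetry; apply sqrt_sqrt; lra).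
clearbody k y S1 S2 S3 S4; clear Hv; subst Q.
(* With sqrt (K z0) / m * u^2 left over, complete the square in K Q u. *)
set (X := (1 + S1) * u - z0 * S2).
set (Q := V + y / k * X).
assert (EV : K * (V * u) = K * Q * u - k * y * (X * u))
  by (unfold Q; rewrite EK; field; lra).
assert (H1 : 0 <= k * y / m * (u - K * m / (2 * k * y) * Q) ^ 2).
{ apply Rmult_le_pos; [|apply pow2_ge_0].
  apply Rdiv_le_0_compat; [apply Rmult_le_pos; lra | exact Hm]. }
assert (H2 : k * y / m * (u - K * m / (2 * k * y) * Q) ^ 2 =
  k * y / m * u ^ 2 - K * Q * u + K * k * m / (4 * y) * Q ^ 2)
  by (rewrite EK; field; lra).
apply (Rmult_le_compat_l (k * y)) in Hsum; [|apply Rmult_le_pos; lra].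
replace (k * (z0 * y) / (4 * (a + b)) * S4)
  with (k * y * (z0 / (4 * (a + b)) * S4)) by (field; lra).
rewrite EV; unfold X; unfold Rdiv in H2; unfold Rdiv in *; nra.
Qed.

(** * Energies of the solution *)

Lemma antideriv_on_partial_t (X D : R) (u du : R -> R -> R) :
  0 <= X -> 0 <= D -> partial_t X D u du -> continuous_on_rect X D du ->
  forall x, 0 <= x <= X ->
  antideriv_on 0 D (clamp2 X D u x) (clamp2 X D du x).
Proof.
intros HX HD Hu Hc x Hx; unfold clamp2; rewrite (clamp_id 0 X x) by exact Hx.
apply (antideriv_on_ext 0 D (u x));
  [intros t Ht; rewrite clamp_id by exact Ht; reflexivity|].
apply (C1_on_antideriv_on 0 D (u x) (du x)); [exact HD|]; split; [apply Hu, Hx|].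
apply (continuous_on_ext _ (clamp2 X D du x));
  [intros t Ht; apply clamp2_id; assumption|].
apply continuous_on_forall; intros t _; apply joint_cont_fix_x, joint_cont_clamp2; assumption.
Qed.

Lemma antideriv_on_partial_x (X D : R) (u du : R -> R -> R) :
  0 <= X -> 0 <= D -> partial_x X D u du -> continuous_on_rect X D du ->
  forall t, 0 <= t <= D ->
  antideriv_on 0 X (fun x => clamp2 X D u x t) (fun x => clamp2 X D du x t).
Proof.
intros HX HD Hu Hc t Ht; unfold clamp2; rewrite (clamp_id 0 D t) by exact Ht.
apply (antideriv_on_ext 0 X (fun x => u x t));
  [intros x Hx; rewrite clamp_id by exact Hx; reflexivity|].
apply (C1_on_antideriv_on 0 X (fun x => u x t) (fun x => du x t));
  [exact HX|]; split; [apply Hu, Ht|].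
apply (continuous_on_ext _ (fun x => clamp2 X D du x t));
  [intros x Hx; apply clamp2_id; assumption|].
apply continuous_on_forall; intros x _.
apply (joint_cont_fix_t (clamp2 X D du)), joint_cont_clamp2; assumption.
Qed.


Lemma energy_increment (X D a K t : R) (v vt p q : R -> R -> R) :
  0 <= X -> 0 <= t <= D -> joint_cont v -> joint_cont vt -> joint_cont p -> joint_cont q ->
  (forall x, 0 < x < X -> antideriv_on 0 D (v x) (vt x)) ->
  (forall x, 0 < x < X -> antideriv_on 0 D (p x) (q x)) ->
  is_RInt
    (fun s => RInt (fun x => a * (v x s * vt x s) + K * (p x s * q x s)) 0 X) 0 t
    ((a / 2 * RInt (fun x => v x t ^ 2) 0 X + K / 2 * RInt (fun x => p x t ^ 2) 0 X)
     - (a / 2 * RInt (fun x => v x 0 ^ 2) 0 X + K / 2 * RInt (fun x => p x 0 ^ 2) 0 X)).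
Proof.
intros HX Ht Cv Cvt Cp Cq Hv Hp.
assert (Ev := RInt_square_increment X D v vt t HX Ht Cv Cvt Hv).
assert (Ep := RInt_square_increment X D p q t HX Ht Cp Cq Hp).
match goal with |- is_RInt _ _ _ (?A * ?A1 + ?B * ?B1 - (?A * ?A0 + ?B * ?B0)) =>
  replace (A * A1 + B * B1 - (A * A0 + B * B0))
    with (plus (scal A (A1 - A0)) (scal B (B1 - B0)))
    by (unfold plus, scal; simpl; unfold mult; simpl; ring) end.
rewrite Ev, Ep.
assert (Cw : forall u ut, joint_cont u -> joint_cont ut ->
    joint_cont (fun x s => 2 * (u x s * ut x s)))
  by (intros u ut Cu Cut; apply (joint_cont_scal 2 (fun x s => u x s * ut x s)),
        joint_cont_mult; assumption).
assert (Ci : forall w s, joint_cont w -> ex_RInt (fun x => w x s) 0 X)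
  by (intros w s Cu; apply ex_RInt_cont, joint_cont_fix_t, Cu).
apply (is_RInt_ext (fun s =>
  plus (scal (a / 2) (RInt (fun x => 2 * (v x s * vt x s)) 0 X))
       (scal (K / 2) (RInt (fun x => 2 * (p x s * q x s)) 0 X)))).
- intros s _; symmetry; apply is_RInt_unique.
  apply (is_RInt_ext (fun x => plus (scal (a / 2) (2 * (v x s * vt x s)))
                                    (scal (K / 2) (2 * (p x s * q x s)))));
    [intros; unfold plus, scal; simpl; unfold mult; simpl; field|].
  apply (@is_RInt_plus R_NormedModule); apply (@is_RInt_scal R_NormedModule);
    apply (@RInt_correct R_CompleteNormedModule).
  + apply (Ci (fun x s => 2 * (v x s * vt x s)) s), Cw; assumption.
  + apply (Ci (fun x s => 2 * (p x s * q x s)) s), Cw; assumption.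
- apply (@is_RInt_plus R_NormedModule); apply (@is_RInt_scal R_NormedModule);
    apply (@RInt_correct R_CompleteNormedModule); apply ex_RInt_cont.
  + apply (RInt_param_continuous (fun x s => 2 * (v x s * vt x s))), Cw; assumption.
  + apply (RInt_param_continuous (fun x s => 2 * (p x s * q x s))), Cw; assumption.
Qed.

(** Multiplying the memory equation by [dz] makes [z + e * ddz] contribute the
    exact derivative of [(z^2 + e * dz^2) / 2]. *)
Lemma memory_energy (D t e c : R) (z dz ddz : R -> R) :
  0 <= t <= D -> C1_on 0 D z dz -> C1_on 0 D dz ddz -> z 0 = 0 -> dz 0 = 0 ->
  is_RInt (fun s => c * (dz s * (z s + e * ddz s))) 0 t
          (c / 2 * (z t ^ 2 + e * dz t ^ 2)).
Proof.
intros Ht Hz Hdz Z0 DZ0.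
assert (Sz := C1_on_antideriv_on 0 D z dz ltac:(lra) Hz).
assert (Sdz := C1_on_antideriv_on 0 D dz ddz ltac:(lra) Hdz).
assert (Cz := continuous_clamp_comp 0 D dz ltac:(lra) (proj2 Hz)).
assert (Cdz := continuous_clamp_comp 0 D ddz ltac:(lra) (proj2 Hdz)).
assert (Iz := is_RInt_mult_deriv 0 D _ _ _ _ 0 t Cz Cz Sz Sz ltac:(lra) ltac:(lra)).
assert (Idz := is_RInt_mult_deriv 0 D _ _ _ _ 0 t Cdz Cdz Sdz Sdz ltac:(lra) ltac:(lra)).
assert (I := is_RInt_plus _ _ _ _ _ _ (is_RInt_scal _ _ _ (c / 2) _ Iz)
                                      (is_RInt_scal _ _ _ (c * e / 2) _ Idz)).
rewrite Z0, DZ0 in I.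
replace (c / 2 * (z t ^ 2 + e * dz t ^ 2))
  with (plus (scal (c / 2) (z t * z t - 0 * 0)) (scal (c * e / 2) (dz t * dz t - 0 * 0)))
  by (unfold plus, scal; simpl; unfold mult; simpl; field).
apply is_RInt_ext with (2 := I).
intros s; rewrite Rmin_left, Rmax_right by lra; intros Hs.
rewrite !clamp_id by lra; unfold plus, scal; simpl; unfold mult; simpl; field.
Qed.

(** The left end point is excluded from the vanishing hypothesis, as the boundary
    condition at [x = 0] is only known for positive times. *)
Lemma antideriv_on_zero (l u : R) (g dg : R -> R) :
  antideriv_on l u g dg -> (forall x, l < x <= u -> g x = 0) ->
  forall x, l < x < u -> dg x = 0.
Proof.
intros [h [H1 E1]] H0 x Hx.
apply (antideriv_on_unique ((l + x) / 2) u (fun _ => 0) dg (fun _ => 0)); [| | lra].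
- exists h; split; [exact H1|]; intros y Hy; rewrite E1 by lra; apply H0; lra.
- exists (fun _ => 0); split; [|reflexivity].
  intros y; apply (@is_derive_const R_AbsRing R_NormedModule).
Qed.

(** * The a priori estimate *)

Lemma Rpower_half (x : R) : 0 < x -> Rpower x (1 / 2) = sqrt x.
Proof. intros Hx; rewrite <- Rpower_sqrt by exact Hx; f_equal; field. Qed.

Lemma Rpower_three_halves (x : R) : 0 < x -> Rpower x (3 / 2) = x * sqrt x.
Proof.
intros Hx; replace (3 / 2) with (1 + / 2) by field.
rewrite Rpower_plus, Rpower_1, Rpower_sqrt by exact Hx; reflexivity.
Qed.

Theorem theorem2p1
  (a b K D xr z0 : R) (N : nat)
  (ha : 0 < a) (hb : 0 < b) (hK : 0 < K) (hD : 0 < D) (hxr : 0 < xr)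
  (hz0 : 0 < z0) (hN : (1 <= N)%nat)
  (f : R -> R -> R) (xi eta phi dphi ddphi dxi1 : R -> R)
  (T Tt Ttt Tx Txx Ttx Ttxx : R -> R -> R)
  (zeta dzeta ddzeta : nat -> R -> R)
  (hdata : admissible_data D xr f xi eta phi dphi ddphi dxi1)
  (hsmooth : smooth_solution D xr N T Tt Ttt Tx Txx Ttx Ttxx
               zeta dzeta ddzeta)
  (hsol : reduced_problem a b K D xr z0 N
            (F_of a f dphi ddphi) (xi1_of xi phi) (eta1_of eta dphi)
            (Q_of K z0 N dphi) (R_of dphi)
            T Tt Ttt Tx Txx Ttx Ttxx zeta dzeta ddzeta) :
  forall t : R, 0 < t <= D ->
    L2_norm_sq xr (fun x => T x t)
    <= xr ^ 2 * Rpower K (1 / 2) * (2 * INR N + 1) / (4 * sqrt z0)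
         * RInt (fun s => Q_of K z0 N dphi s ^ 2) 0 t
       + xr ^ 2 * Rpower z0 (3 / 2) / (4 * sqrt K * (a + b))
         * RInt (fun s =>
             sum_n_m (fun n => coef_a N n / coef_b N n ^ 2 * R_of dphi s ^ 2)
               1 N) 0 t
       + xr ^ 2 / 2 * L2_norm_sq xr dxi1
       + xr ^ 2 / (2 * K)
         * RInt (fun s => L2_norm_sq xr (fun x => F_of a f dphi ddphi x s)) 0 t
       + a * xr ^ 2 / (2 * K) * L2_norm_sq xr (eta1_of eta dphi).
Proof.
intros t Ht.
rewrite Rpower_half, Rpower_three_halves by assumption; unfold L2_norm_sq.
destruct hsmooth as [sTt sTtt sTx sTxx sTtx sTtxx
                     cT cTt cTtt cTx cTxx cTtx cTtxx sdz sddz].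
destruct hsol as [hpde hT0 hTt0 hleft hright hzeta hz0' hdz0].
assert (Hx0 : 0 <= xr) by lra; assert (HD0 : 0 <= D) by lra.
set (F := F_of a f dphi ddphi) in *.
set (Q := Q_of K z0 N dphi) in *.
set (r := R_of dphi) in *.
set (g := clamp2 xr D T); set (v := clamp2 xr D Tt); set (vt := clamp2 xr D Ttt).
set (p := clamp2 xr D Tx); set (px := clamp2 xr D Txx).
set (q := clamp2 xr D Ttx); set (qx := clamp2 xr D Ttxx).
assert (Cv : joint_cont v) by (apply joint_cont_clamp2; assumption).
assert (Cvt : joint_cont vt) by (apply joint_cont_clamp2; assumption).
assert (Cp : joint_cont p) by (apply joint_cont_clamp2; assumption).
assert (Cpx : joint_cont px) by (apply joint_cont_clamp2; assumption).
assert (Cq : joint_cont q) by (apply joint_cont_clamp2; assumption).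
assert (Cqx : joint_cont qx) by (apply joint_cont_clamp2; assumption).
assert (Dgt : forall x, 0 <= x <= xr -> antideriv_on 0 D (g x) (v x))
  by (apply antideriv_on_partial_t; assumption).
assert (Dvt : forall x, 0 <= x <= xr -> antideriv_on 0 D (v x) (vt x))
  by (apply antideriv_on_partial_t; assumption).
assert (Dgx : forall s, 0 <= s <= D ->
    antideriv_on 0 xr (fun x => g x s) (fun x => p x s))
  by (apply antideriv_on_partial_x; assumption).
assert (Dpx : forall s, 0 <= s <= D ->
    antideriv_on 0 xr (fun x => p x s) (fun x => px x s))
  by (apply antideriv_on_partial_x; assumption).
assert (Dvx : forall s, 0 <= s <= D ->
    antideriv_on 0 xr (fun x => v x s) (fun x => q x s))
  by (apply antideriv_on_partial_x; assumption).
assert (Dqx : forall s, 0 <= s <= D ->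
    antideriv_on 0 xr (fun x => q x s) (fun x => qx x s))
  by (apply antideriv_on_partial_x; assumption).
assert (Dpt := antideriv_on_mixed xr D g v p q HD0 Cv Cp Cq Dgt Dgx Dvx).
assert (Hv0 : forall s, 0 < s < D -> v 0 s = 0).
{ apply (antideriv_on_zero 0 D (g 0)); [apply Dgt; lra|].
  intros s Hs; unfold g; rewrite clamp2_id by lra; apply hleft, Hs. }
(* At time 0 the initial condition gives T, not T_x; both p and dxi1 are
   derivatives of the same function of x. *)
assert (Hp0 : forall x, 0 < x < xr -> p x 0 = dxi1 x).
{ intros x Hx; rewrite <- (clamp_id 0 xr x) at 2 by lra.
  apply (antideriv_on_unique 0 xr (fun x => g x 0) (fun x => p x 0)
    (fun x => dxi1 (clamp 0 xr x))); [apply Dgx; lra | | exact Hx].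
  apply (antideriv_on_ext 0 xr (xi1_of xi phi)).
  - intros y Hy; unfold g; rewrite clamp2_id by lra; symmetry; apply hT0, Hy.
  - apply C1_on_antideriv_on; [exact Hx0 | apply (data_dxi1 _ _ _ _ _ _ _ _ _ hdata)]. }
assert (IE := energy_increment xr D a K t v vt p q Hx0 ltac:(lra) Cv Cvt Cp Cq
  (fun x Hx => Dvt x ltac:(lra)) Dpt).
set (w := fun n s => zeta n s + a * b * ddzeta n s).
assert (IM : is_RInt
  (fun s => sum_n_m (fun n => z0 * coef_a N n * (dzeta n s * w n s)) 1 N) 0 t
  (sum_n_m (fun n => z0 * coef_a N n / 2
                     * (zeta n t ^ 2 + a * b * dzeta n t ^ 2)) 1 N)).
{ apply (is_RInt_sum_n_m (fun n s => z0 * coef_a N n * (dzeta n s * w n s))).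
  intros n Hn.
  apply (memory_energy D); auto; lra. }
set (M := sum_n_m _ 1 N) in IM.
assert (HM : 0 <= M).
{ replace 0 with (sum_n_m (fun _ => 0) 1 N)
    by (apply (@sum_n_m_const_zero R_AbelianMonoid)).
  apply sum_n_m_le_loc; intros n Hn.
  assert (Hb1 := coef_b_le_1 N n).
  assert (0 < 2 / (2 * INR N + 1))
    by (apply Rdiv_lt_0_compat; [lra | assert (P := pos_INR N); lra]).
  assert (0 <= coef_a N n) by (rewrite coef_a_eq; apply Rmult_le_pos; lra).
  apply Rmult_le_pos.
  - apply Rdiv_le_0_compat; [apply Rmult_le_pos; lra | lra].
  - apply Rplus_le_le_0_compat; [apply pow2_ge_0|].
    apply Rmult_le_pos; [apply Rmult_le_pos; lra | apply pow2_ge_0]. }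
set (cQ := K * sqrt K * (2 * INR N + 1) / (4 * sqrt z0)).
set (cR := sqrt K * (z0 * sqrt z0) / (4 * (a + b))).
set (G := fun s => sum_n_m (fun n => coef_a N n / coef_b N n ^ 2 * r s ^ 2) 1 N).
assert (Cr2 : ex_RInt (fun s => r s ^ 2) 0 t).
{ apply (ex_RInt_ext (fun s => dphi (clamp 0 D s) * dphi (clamp 0 D s))).
  - intros s; rewrite Rmin_left, Rmax_right by lra; intros Hs.
    rewrite clamp_id by lra; unfold r, R_of; simpl; ring.
  - apply ex_RInt_cont; intros s; apply (@continuous_mult _ R_AbsRing);
      apply continuous_clamp_comp; try assumption;
      apply (data_dphi _ _ _ _ _ _ _ _ _ hdata). }
assert (HQ : ex_RInt (fun s => Q s ^ 2) 0 t).
{ set (cst := - sqrt (z0 / K) * (1 + sum_n_m (fun n => coef_a N n / coef_b N n) 1 N)).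
  apply (ex_RInt_ext (fun s => scal (cst ^ 2) (r s ^ 2))).
  - intros s _; unfold Q, Q_of, r, R_of, scal; simpl; unfold mult; simpl; fold cst; ring.
  - apply (@ex_RInt_scal R_NormedModule), Cr2. }
assert (HG : ex_RInt G 0 t).
{ eexists; apply (is_RInt_sum_n_m (fun n s => coef_a N n / coef_b N n ^ 2 * r s ^ 2)).
  intros n _; apply (@is_RInt_scal R_NormedModule (fun s => r s ^ 2)).
  apply (@RInt_correct R_CompleteNormedModule), Cr2. }
(* Through the equation, F is a combination of jointly continuous functions for
   positive times, which is all that an integral from 0 sees. *)
assert (HF : ex_RInt (fun s => RInt (fun x => F x s ^ 2) 0 xr) 0 t).
{ set (Fe := fun x s => v x s + (a * vt x s + - K * (px x s + b * qx x s))).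
  apply (ex_RInt_ext (fun s => RInt (fun x => Fe x s * Fe x s) 0 xr)).
  - intros s; rewrite Rmin_left, Rmax_right by lra; intros Hs.
    apply RInt_ext; intros x; rewrite Rmin_left, Rmax_right by lra; intros Hx.
    assert (EF : Fe x s = F x s).
    { unfold Fe, v, vt, px, qx; rewrite !clamp2_id by lra.
      assert (H := hpde x s ltac:(lra) ltac:(lra)); lra. }
    rewrite EF; simpl; ring.
  - apply ex_RInt_cont, (RInt_param_continuous (fun x s => Fe x s * Fe x s)).
    assert (CF : joint_cont Fe).
    { apply (joint_cont_plus v); [exact Cv|].
      apply (joint_cont_plus (fun x s => a * vt x s)); [apply joint_cont_scal, Cvt|].
      apply (joint_cont_scal (- K) (fun x s => px x s + b * qx x s)).
      apply (joint_cont_plus px); [exact Cpx | apply joint_cont_scal, Cqx]. }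
    apply joint_cont_mult; exact CF. }
assert (IB := is_RInt_plus _ _ _ _ _ _
  (is_RInt_plus _ _ _ _ _ _
    (is_RInt_scal _ _ _ cQ _ (RInt_correct _ _ _ HQ))
    (is_RInt_scal _ _ _ cR _ (RInt_correct _ _ _ HG)))
  (is_RInt_scal _ _ _ (/ 2) _ (RInt_correct _ _ _ HF))).
assert (IP := is_RInt_plus _ _ _ _ _ _ IE (is_RInt_scal _ _ _ (sqrt (K * z0)) _ IM)).
assert (Hle : forall s, 0 < s < t ->
  RInt (fun x => a * (v x s * vt x s) + K * (p x s * q x s)) 0 xr
  + sqrt (K * z0) * sum_n_m (fun n => z0 * coef_a N n * (dzeta n s * w n s)) 1 N
  <= cQ * Q s ^ 2 + cR * G s + / 2 * RInt (fun x => F x s ^ 2) 0 xr).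
{ intros s Hs.
  assert (H1 := energy_flux_le xr a b K (fun x => v x s) (fun x => vt x s)
    (fun x => p x s) (fun x => px x s) (fun x => q x s) (fun x => qx x s) (fun x => F x s)
    Hx0 ltac:(lra) ltac:(lra)
    (joint_cont_fix_t v s Cv) (joint_cont_fix_t vt s Cvt) (joint_cont_fix_t p s Cp)
    (joint_cont_fix_t px s Cpx) (joint_cont_fix_t q s Cq) (joint_cont_fix_t qx s Cqx)
    (Dvx s ltac:(lra)) (Dpx s ltac:(lra)) (Dqx s ltac:(lra)) (Hv0 s ltac:(lra))).
  assert (H2 := boundary_power_le a b K z0 N (Q s) (r s) (v xr s) (p xr s + b * q xr s)
    (fun n => dzeta n s) (fun n => w n s) ltac:(lra) hK hz0).
  fold cQ cR in H2.
  change (sum_n_m (fun n => coef_a N n / coef_b N n ^ 2 * r s ^ 2) 1 N) with (G s) in H2.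
  cbv beta in H1.
  assert (H3 : forall x, 0 <= x <= xr ->
    v x s + a * vt x s = K * (px x s + b * qx x s) + F x s).
  { intros x Hx; unfold v, vt, px, qx; rewrite !clamp2_id by lra; apply hpde; lra. }
  specialize (H1 H3).
  assert (E : v xr s = Tt xr s /\ p xr s = Tx xr s /\ q xr s = Ttx xr s)
    by (unfold v, p, q; rewrite !clamp2_id by lra; auto).
  destruct E as [E1 [E2 E3]]; rewrite E1, E2, E3 in H1, H2.
  specialize (H2 (hright s ltac:(lra))).
  assert (H4 : forall n, (1 <= n <= N)%nat ->
    (z0 - coef_b N n * z0) * dzeta n s + coef_b N n * (w n s + (a + b) * dzeta n s)
    = Tt xr s + r s).
  { intros n Hn; rewrite <- (hzeta n s Hn ltac:(lra)); unfold w; ring. }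
  specialize (H2 H4); lra. }
assert (Hmain := is_RInt_le _ _ _ _ _ _ (Rlt_le _ _ (proj1 Ht)) IP IB Hle).
assert (Hpoin := poincare_left_zero xr (fun x => g x t) (fun x => p x t) Hx0
  (joint_cont_fix_t p t Cp) (Dgx t ltac:(lra))).
assert (Hg0 : g 0 t = 0) by (unfold g; rewrite clamp2_id by lra; apply hleft, Ht).
specialize (Hpoin Hg0); cbv beta in Hpoin.
assert (Eg : RInt (fun x => g x t ^ 2) 0 xr = RInt (fun x => T x t ^ 2) 0 xr).
{ apply RInt_ext; intros x; rewrite Rmin_left, Rmax_right by lra; intros Hx.
  unfold g; rewrite clamp2_id by lra; reflexivity. }
assert (Ev : RInt (fun x => v x 0 ^ 2) 0 xr = RInt (fun x => eta1_of eta dphi x ^ 2) 0 xr).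
{ apply RInt_ext; intros x; rewrite Rmin_left, Rmax_right by lra; intros Hx.
  unfold v; rewrite clamp2_id, hTt0 by lra; reflexivity. }
assert (Ep : RInt (fun x => p x 0 ^ 2) 0 xr = RInt (fun x => dxi1 x ^ 2) 0 xr).
{ apply RInt_ext; intros x; rewrite Rmin_left, Rmax_right by lra; intros Hx.
  rewrite Hp0 by exact Hx; reflexivity. }
assert (Hv2 : 0 <= RInt (fun x => v x t ^ 2) 0 xr).
{ apply RInt_ge_0; [exact Hx0 | | intros; apply pow2_ge_0].
  apply ex_RInt_cont; intros x.
  apply (continuous_ext (fun x => v x t * v x t)); [intros; simpl; ring|].
  apply (joint_cont_fix_t (fun x s => v x s * v x s)), joint_cont_mult; exact Cv. }
rewrite Eg in Hpoin; rewrite Ev, Ep in Hmain.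
change (fun s => sum_n_m (fun n => coef_a N n / coef_b N n ^ 2 * r s ^ 2) 1 N) with G.
set (IQ := RInt (fun s => Q s ^ 2) 0 t) in *.
set (IG := RInt G 0 t) in *.
set (IF := RInt (fun s => RInt (fun x => F x s ^ 2) 0 xr) 0 t) in *.
set (X2 := RInt (fun x => dxi1 x ^ 2) 0 xr) in *.
set (Y2 := RInt (fun x => eta1_of eta dphi x ^ 2) 0 xr) in *.
set (P2 := RInt (fun x => p x t ^ 2) 0 xr) in *.
set (V2 := RInt (fun x => v x t ^ 2) 0 xr) in *.
set (T2 := RInt (fun x => T x t ^ 2) 0 xr) in *.
change (a / 2 * V2 + K / 2 * P2 - (a / 2 * Y2 + K / 2 * X2) + sqrt (K * z0) * M
  <= cQ * IQ + cR * IG + / 2 * IF) in Hmain.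
assert (HsM : 0 <= sqrt (K * z0) * M) by (apply Rmult_le_pos; [apply sqrt_pos | exact HM]).
assert (HaV : 0 <= a / 2 * V2) by (apply Rmult_le_pos; lra).
assert (Hk := sqrt_lt_R0 K hK); assert (Hy := sqrt_lt_R0 z0 hz0).
assert (EK := sqrt_sqrt K ltac:(lra)).
apply Rle_trans with (1 := Hpoin).
apply Rle_trans with (xr ^ 2 / K
  * (cQ * IQ + cR * IG + / 2 * IF + (a / 2 * Y2 + K / 2 * X2))).
- replace (xr ^ 2 / 2 * P2) with (xr ^ 2 / K * (K / 2 * P2)) by (field; lra).
  apply Rmult_le_compat_l; [|lra].
  apply Rdiv_le_0_compat; [apply pow2_ge_0 | exact hK].
- right; unfold cQ, cR.
  set (k := sqrt K) in *; clearbody k; clear - EK Hk Hy ha hb; subst K; field; lra.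
Qed.
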